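(* Let $\mathscr{D}\subseteq\mathscr{U}(n,q^s)$ be a space of competing balanced lattice designs. A design $\mathbf{X}\in\mathscr{D}$ is majorant in $\mathscr{D}$ if and only if, for every convex function $\psi:\mathbb{R}_+\to\mathbb{R}$, $\mathbf{X}$ is Schur-$\psi$ optimum in $\mathscr{D}$. Moreover, for every convex $\psi:\mathbb{R}_+\to\mathbb{R}$, the Schur-$\psi$ criterion has the lower bound $$\Psi(\mathbf{X};\psi)\ \ge\ m(1-f)\,\psi(\theta)+m f\,\psi(\theta+1)\qquad\text{for all }\mathbf{X}\in\mathscr{D}.$$
   Context: $\mathbb{R}_+=[0,\infty)$. Let $n,q\ge 2$, $s\ge 1$ be integers and $\mathcal{L}(q^s)=\{0,1,\dots,q-1\}^s$. A lattice design $\mathbf{X}=\mathbf{X}(n,q^s)$ is a collection of $n$ points (runs, repetitions allowed) $\mathbf{x}_1,\dots,\mathbf{x}_n\in\mathcal{L}(q^s)$, written as an $n\times s$ matrix $(x_{ij})$. It is balanced if in each column each of the $q$ levels appears equally often ($n/q$ times); $\mathscr{U}(n,q^s)$ is the set of balanced designs. The coincidence of $\mathbf{x},\mathbf{w}\in\mathcal{L}(q^s)$ is $\beta(\mathbf{x},\mathbf{w})=\sum_{j=1}^s\delta_{x_j,w_j}$ (Kronecker delta), i.e. the number of coordinates in which they agree. With $m=n(n-1)/2$, the pairwise coincidence (PC) vector of $\mathbf{X}$ is $\boldsymbol{\beta}(\mathbf{X})=(\beta_1,\dots,\beta_m)'$, the list of the values $\beta(\mathbf{x}_i,\mathbf{x}_k)$,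 $1\le i<k\le n$. For $\mathbf{x},\mathbf{y}\in\mathbb{R}_+^m$ with increasing order statistics $x_{[1]}\le\dots\le x_{[m]}$, $y_{[1]}\le\dots\le y_{[m]}$, $\mathbf{x}$ is majorized by $\mathbf{y}$, written $\mathbf{x}\preceq\mathbf{y}$, if $\sum_{r=1}^k x_{[r]}\ge\sum_{r=1}^k y_{[r]}$ for $k=1,\dots,m-1$ and $\sum_{r=1}^m x_r=\sum_{r=1}^m y_r$. $\mathbf{X}\in\mathscr{D}$ is majorant (in $\mathscr{D}$) if $\boldsymbol{\beta}(\mathbf{X})\preceq\boldsymbol{\beta}(\mathbf{X}')$ for all $\mathbf{X}'\in\mathscr{D}$. For a convex kernel $\psi:\mathbb{R}_+\to\mathbb{R}$, the Schur-$\psi$ criterion is $\Psi(\mathbf{X};\psi)=\sum_{r=1}^m\psi(\beta_r(\mathbf{X}))$, and $\mathbf{X}\in\mathscr{D}$ is Schur-$\psi$ optimum if $\Psi(\mathbf{X};\psi)\le\Psi(\mathbf{X}';\psi)$ for all $\mathbf{X}'\in\mathscr{D}$. $\theta$ and $f$ are the integral part and fractional part of $\bar\beta=\frac{s(n-q)}{q(n-1)}$, i.e. $\theta=\lfloor\bar\beta\rfloor$ and $f=\bar\beta-\theta$. *)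

(* Defs.v *)
From HB Require Import structures.
From mathcomp Require Import all_boot all_order all_algebra.
From mathcomp Require Import classical_sets set_interval reals convex.

Set Implicit Arguments.
Unset Strict Implicit.
Unset Printing Implicit Defensive.

Import Order.TTheory GRing.Theory Num.Theory.

Local Open Scope ring_scope.

(* A lattice design X(n, q^s): row i is the i-th run; repeated rows allowed. *)
Notation design n q s := 'M['I_q]_(n, s).

Definition balanced (n q s : nat) (X : design n q s) : bool :=
  [forall j, forall l, #|[set i | X i j == l]| * q == n]%N.

Definition balanced_designs (n q s : nat) : {set design n q s} :=
  [set X | balanced X].

Definition coincidence (q s : nat) (x w : 'rV['I_q]_s) : nat :=
  (\sum_(j < s) (x 0%R j == w 0%R j))%N.

Definition npairs (n : nat) : nat := ((n * n.-1)./2)%N.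

Definition run_pairs (n : nat) : seq ('I_n * 'I_n) :=
  [seq p : 'I_n * 'I_n <- enum {: 'I_n * 'I_n} | (p.1 < p.2)%N].

Lemma size_run_pairs (n : nat) : size (run_pairs n) == npairs n.
Proof.
apply/eqP; rewrite /npairs -bin2 -bin2_sum big_mkord /run_pairs size_filter.
rewrite -sum1_count big_enum_cond /= -(pair_big_dep xpredT
  (fun i k : 'I_n => (i < k)%N) (fun _ _ => 1%N)) /=.
rewrite (exchange_big_dep xpredT) //=; apply: eq_bigr => k _.
by rewrite (big_ord_narrow (ltnW (ltn_ord k))) sum1_card card_ord.
Qed.

Canonical run_pairs_tuple (n : nat) := Tuple (size_run_pairs n).

Definition pc_vector (R : realType) (n q s : nat) (X : design n q s) :
    (npairs n).-tuple R :=
  [tuple of [seq (coincidence (row p.1 X) (row p.2 X))%:R | p <- run_pairs n]].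

(* majorized x y : x is majorized by y.  The order statistics, x_[1] being the
   smallest, are the entries of the increasing rearrangement, counted from 0.
   The same formula makes sense without the nonnegativity of the entries. *)
Definition majorized (R : realType) (m : nat) (x y : m.-tuple R) : Prop :=
  (forall k : nat, (0 < k < m)%N ->
     \sum_(r < k) (sort <=%R y)`_r <= \sum_(r < k) (sort <=%R x)`_r) /\
  \sum_(r < m) tnth x r = \sum_(r < m) tnth y r.

Definition majorant (R : realType) (n q s : nat) (D : {set design n q s})
    (X : design n q s) : Prop :=
  X \in D /\
  forall X', X' \in D -> majorized (pc_vector R X) (pc_vector R X').

(* A convex kernel on [0, +oo[ is represented by a function on R, of which only
   the values on [0, +oo[ are constrained, or used below. *)
Definition convex_kernel (R : realType) (psi : R -> R) : Prop :=
  convex_function (`[0, +oo[%classic : set R^o) psi.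

Definition schur_criterion (R : realType) (n q s : nat) (psi : R -> R)
    (X : design n q s) : R :=
  \sum_(r < npairs n) psi (tnth (pc_vector R X) r).

Definition schur_optimum (R : realType) (n q s : nat) (psi : R -> R)
    (D : {set design n q s}) (X : design n q s) : Prop :=
  X \in D /\
  forall X', X' \in D -> schur_criterion psi X <= schur_criterion psi X'.

Definition mean_coincidence (R : realType) (n q s : nat) : R :=
  s%:R * (n%:R - q%:R) / (q%:R * (n%:R - 1)).

Definition theta (R : realType) (n q s : nat) : int :=
  Num.floor (mean_coincidence R n q s).

Definition frac_part (R : realType) (n q s : nat) : R :=
  mean_coincidence R n q s - (theta R n q s)%:~R.

(* Main.v *)
(* Coincidences are natural numbers, and at a natural number [a] the forward
   difference [psi (a + 1) - psi a] is the slope of a line below [psi] at all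
   natural numbers, even when [psi] has no subgradient at [0].  Summation by
   parts against these slopes, which increase with [a], gives Karamata's
   inequality.  Balance fixes the mean of the PC vector, so summing the
   supporting line at [theta] gives the lower bound. *)

Require Import Defs.
From mathcomp Require Import all_boot all_order all_algebra.
From mathcomp Require Import classical_sets set_interval reals convex.
From mathcomp Require Import interval_inference ring lra.

Import Order.TTheory GRing.Theory Num.Theory.

Local Open Scope ring_scope.

(** * Convexity inequalities for a kernel on the half-line *)

(** Trades the bundled weights in [0, 1] of [convex_function] for an explicit inequality that linear
    arithmetic can use. *)
Lemma convex_kernelP (R : realType) (psi : R -> R) :
  convex_kernel psi <->
  (forall t x y : R, 0 <= t <= 1 -> 0 <= x -> 0 <= y ->
     psi (t * x + (1 - t) * y) <= t * psi x + (1 - t) * psi y).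
Proof.
have in0 (x : R) : (x \in (`[0, +oo[%classic : set R)) = (0 <= x).
  by rewrite mem_setE in_itv /= andbT.
split=> [psiC t x y t01 x0 y0|psiC t x y].
- have t01' : Itv.spec (@Itv.num_sem R) (Itv.Real `[0%Z, 1%Z]) t.
    by rewrite /= /Itv.num_sem /= in_itv /= t01 andbT num_real.
  have := psiC (Itv.mk t01') x y; rewrite !in0 => /(_ x0 y0).
  by rewrite !convRE.
- rewrite !in0 => x0 y0; rewrite !convRE; apply: psiC => //.
  by rewrite ge0 le1.
Qed.

(** Convexity with weight [(z - y) / (z - x)], cleared of denominators so that [x = z] is covered
    too. *)
Lemma convex_kernel_chord (R : realType) (psi : R -> R) (x y z : R) :
  convex_kernel psi -> 0 <= x -> x <= y -> y <= z ->
  (z - x) * psi y <= (z - y) * psi x + (y - x) * psi z.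
Proof.
move=> /convex_kernelP psiC x0 xy yz.
have [xz|zx] := ltP x z; last first.
  have -> : y = x by lra.
  have -> : z = x by lra.
  by rewrite subrr !mul0r addr0.
have zx0 : 0 < z - x by rewrite subr_gt0.
have zxN : z - x != 0 by rewrite gt_eqF.
have t01 : 0 <= (z - y) / (z - x) <= 1.
  by rewrite divr_ge0 ?subr_ge0 ?(ltW xz) //= ler_pdivrMr // mul1r; lra.
have z0 : 0 <= z by lra.
have := psiC _ _ _ t01 x0 z0.
have -> : (z - y) / (z - x) * x + (1 - (z - y) / (z - x)) * z = y by field.
rewrite -(ler_pM2l zx0); congr (_ <= _); field=> //.
Qed.

(** The chord inequality for [b <= a < a + 1] or for [a < a + 1 <= b]. No point to the left of both
    [a] and [b] enters, so [a = 0] is not special. *)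
Lemma convex_kernel_support (R : realType) (psi : R -> R) (a b : nat) :
  convex_kernel psi ->
  psi a%:R + (psi (a%:R + 1) - psi a%:R) * (b%:R - a%:R) <= psi b%:R.
Proof.
move=> psiC; have a0 := ler0n R a; have b0 := ler0n R b.
case: (leqP b a) => [|]; rewrite -(ler_nat R) ?mulrSr => ab.
  have := convex_kernel_chord R psi b%:R a%:R (a%:R + 1) psiC b0 ab.
  by move=> /(_ (ltac:(lra))); lra.
have := convex_kernel_chord R psi a%:R (a%:R + 1) b%:R psiC a0.
by move=> /(_ (ltac:(lra)) ab); lra.
Qed.

(** * Order statistics and Karamata's inequality *)

Lemma sum_tnth_sort {R : realType} {m : nat} (x : m.-tuple R) (f : R -> R) :
  \sum_(r < m) f (tnth x r) = \sum_(r < m) f (sort <=%R x)`_r.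
Proof.
rewrite -(big_tuple _ _ x xpredT f) (perm_big (sort <=%R x)) /=; last first.
  by rewrite perm_sym perm_sort.
by rewrite (big_nth 0) size_sort size_tuple big_mkord.
Qed.

Lemma nth_sort_le {R : realType} (s : seq R) (i j : nat) :
  (i <= j < size s)%N -> (sort <=%R s)`_i <= (sort <=%R s)`_j.
Proof.
move=> /andP[ij js]; apply: (sorted_leq_nth le_trans lexx) => //.
- exact: sort_le_sorted.
- by rewrite inE size_sort (leq_ltn_trans ij).
- by rewrite inE size_sort.
Qed.

(** Summation by parts as an induction: raising the factor [c k] to [c k.+1] in front of a
    nonpositive partial sum only lowers the product, and the last partial sum is 0. *)
Lemma sum_monotone_weight_ge0 {R : realType} {m : nat} (c d : nat -> R) :
  (forall i, (i.+1 < m)%N -> c i <= c i.+1) ->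
  (forall k, (0 < k < m)%N -> \sum_(i < k) d i <= 0) ->
  \sum_(i < m) d i = 0 -> 0 <= \sum_(i < m) c i * d i.
Proof.
case: m => [|m] cM dN d0; first by rewrite big_ord0.
suff /(_ m (leqnn _)) : forall k, (k < m.+1)%N ->
    c k * \sum_(i < k.+1) d i <= \sum_(i < k.+1) c i * d i.
  by rewrite d0 mulr0.
elim=> [|k IHk] km; first by rewrite !big_ord1.
rewrite [in leRHS]big_ord_recr [in leLHS]big_ord_recr mulrDr lerD2r.
apply: le_trans (IHk (ltnW km)).
by apply: ler_wnM2r; [exact: dN | exact: cM].
Qed.

(** Supporting lines are asked for only between points of [P], so that [P] can be the natural
    numbers. The lines at the sorted entries of [x] bound the differences of [psi] termwise from
    below. *)
Lemma majorized_sum_le {R : realType} {m : nat} {P : R -> Prop}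
    {psi slope : R -> R} (x y : m.-tuple R) :
  (forall a b, P a -> P b -> psi a + slope a * (b - a) <= psi b) ->
  (forall r, P (tnth x r)) -> (forall r, P (tnth y r)) -> majorized x y ->
  \sum_(r < m) psi (tnth x r) <= \sum_(r < m) psi (tnth y r).
Proof.
move=> supp Px Py [lexy eqxy].
have Ps (z : m.-tuple R) i : (forall r, P (tnth z r)) -> (i < m)%N ->
    P (sort <=%R z)`_i.
  move=> Pz im; have /tnthP[r ->] // : (sort <=%R z)`_i \in z.
  by rewrite -(mem_sort <=%R) mem_nth // size_sort size_tuple.
set xs := sort <=%R x; set ys := sort <=%R y.
have : 0 <= \sum_(i < m) slope xs`_i * (ys`_i - xs`_i).
  apply: (sum_monotone_weight_ge0 (fun i => slope xs`_i)
    (fun i => ys`_i - xs`_i)).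
  - move=> i im; have Pi := Ps x i Px (ltnW im); have Pj := Ps x i.+1 Px im.
    have le_ij : xs`_i <= xs`_i.+1 by apply: nth_sort_le; rewrite leqnSn size_tuple.
    (* Adding the two supporting inequalities between distinct points shows that the slope
       increases. *)
    have [eq_ij|ne_ij] := eqVneq xs`_i xs`_i.+1; first by rewrite eq_ij.
    have lt_ij : 0 < xs`_i.+1 - xs`_i by rewrite subr_gt0 lt_neqAle ne_ij.
    rewrite -(ler_pM2r lt_ij).
    by have := supp _ _ Pi Pj; have := supp _ _ Pj Pi; rewrite -/xs; lra.
  - by move=> k km; rewrite sumrB subr_le0 lexy.
  - rewrite sumrB -(sum_tnth_sort y id) -(sum_tnth_sort x id) /= eqxy.
    exact: subrr.
move=> /le_trans ge0; rewrite -subr_ge0 !sum_tnth_sort -sumrB; apply: ge0.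
by apply: ler_sum => i _; have := supp _ _ (Ps x i Px _) (Ps y i Py _);
  move=> /(_ (ltn_ord i) (ltn_ord i)); rewrite -/xs -/ys; lra.
Qed.

(* Testing against the kernel [max 0 (c - t)], with [c] the entry of [y] of
   rank [k], isolates the sum of the [k] smallest entries. *)
Lemma majorized_of_convex_kernel {R : realType} {m : nat} (x y : m.-tuple R) :
  (forall psi : R -> R, convex_kernel psi ->
     \sum_(r < m) psi (tnth x r) <= \sum_(r < m) psi (tnth y r)) ->
  majorized x y.
Proof.
move=> le_psi; split=> [k /andP[k0 km]|]; last first.
  (* The identity and its opposite are both convex, which forces equal totals. *)
  apply/eqP; rewrite eq_le (le_psi id) /=; last first.
    by apply/convex_kernelP => *; exact: lexx.
  rewrite -lerN2 -!sumrN (le_psi -%R) //.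
  by apply/convex_kernelP => *; lra.
set xs := sort <=%R x; set ys := sort <=%R y; pose c := ys`_k.
pose psi (t : R) := Num.max 0 (c - t).
have psiC : convex_kernel psi.
  apply/convex_kernelP => t a b /andP[t0 t1] _ _.
  have psi_ge0 u : 0 <= psi u by rewrite le_max lexx.
  have psi_ge u : c - u <= psi u by rewrite le_max lexx orbT.
  have t1' : 0 <= 1 - t by rewrite subr_ge0.
  rewrite {1}/psi ge_max addr_ge0 ?mulr_ge0 //=.
  have := lerD (ler_wpM2l t0 (psi_ge a)) (ler_wpM2l t1' (psi_ge b)); lra.
have := le_psi psi psiC; rewrite !sum_tnth_sort -/xs -/ys.
have split_sum (F : nat -> R) :
    \sum_(i < m) F i = \sum_(i < k) F i + \sum_(k <= i < m) F i.
  by rewrite -!(big_mkord xpredT F) -big_cat_nat /= ?(ltnW km).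
rewrite (split_sum (fun i => psi xs`_i)) (split_sum (fun i => psi ys`_i)).
(* Indices start at 0: the [k] entries of [ys] before [c] are at most [c], the others at least [c].
   So the kernel is evaluated exactly on [ys], while on [xs] a lower bound is enough. *)
have -> : \sum_(k <= i < m) psi ys`_i = 0.
  rewrite big_nat; apply: big1 => i ik; apply/max_idPl; rewrite subr_le0.
  by apply: nth_sort_le; rewrite size_tuple.
have -> : \sum_(i < k) psi ys`_i = \sum_(i < k) (c - ys`_i).
  apply: eq_bigr => i _; apply/max_idPr; rewrite subr_ge0.
  by apply: nth_sort_le; rewrite size_tuple km ltnW.
have tail_ge0 : 0 <= \sum_(k <= i < m) psi xs`_i.
  by apply: sumr_ge0 => i _; rewrite le_max lexx.
have head_ge : \sum_(i < k) (c - xs`_i) <= \sum_(i < k) psi xs`_i.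
  by apply: ler_sum => i _; rewrite le_max lexx orbT.
move: head_ge; rewrite !sumrB; lra.
Qed.

(** * The total coincidence of a balanced design *)

Lemma coincidence_sym (q s : nat) (x w : 'rV['I_q]_s) :
  coincidence x w = coincidence w x.
Proof. by apply: eq_bigr => j _; rewrite eq_sym. Qed.

Lemma coincidence_id (q s : nat) (x : 'rV['I_q]_s) : coincidence x x = s.
Proof.
by rewrite /coincidence; under eq_bigr do rewrite eqxx; rewrite sum1_card card_ord.
Qed.

(** The square of ordered pairs is the diagonal plus two triangles exchanged by symmetry. *)
Lemma sum_sym_pairs (n : nat) (F : 'I_n -> 'I_n -> nat) :
  (forall i k, F i k = F k i) ->
  (\sum_i \sum_k F i k =
     2 * (\sum_(p <- run_pairs n) F p.1 p.2) + \sum_i F i i)%N.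
Proof.
move=> Fsym.
have -> : (\sum_(p <- run_pairs n) F p.1 p.2 =
    \sum_(i < n) \sum_(k < n | i < k) F i k)%N.
  by rewrite /run_pairs big_filter big_enum_cond /= pair_big_dep.
have -> : (\sum_i \sum_k F i k = \sum_(i < n) ((\sum_(k < n | i < k) F i k +
    \sum_(k < n | k < i) F i k) + F i i))%N.
  apply: eq_bigr => i _; rewrite (bigD1 i) //= addnC; congr (_ + _)%N.
  rewrite (bigID (fun k : 'I_n => (i < k)%N)) /=; congr (_ + _)%N;
    apply: eq_bigl => k; rewrite -(inj_eq val_inj) /=; by case: ltngtP.
rewrite !big_split /= mul2n -addnn; congr (_ + _ + _)%N.
rewrite (exchange_big_dep xpredT) //=.
by apply: eq_bigr => i _; apply: eq_bigr => k _; exact: Fsym.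
Qed.

(** Double counting: in each column, each run agrees with exactly n/q runs, itself included. The
    factor [q] avoids the division. *)
Lemma sum_coincidence_all {n q s : nat} {X : design n q s} : balanced X ->
  ((\sum_i \sum_k coincidence (row i X) (row k X)) * q = s * n ^ 2)%N.
Proof.
move=> /forallP balX.
have -> : (\sum_i \sum_k coincidence (row i X) (row k X) =
    \sum_j \sum_i #|[set k | X k j == X i j]|)%N.
  rewrite exchange_big [RHS]exchange_big /=; apply: eq_bigr => i _.
  rewrite /coincidence exchange_big /=; apply: eq_bigr => j _.
  rewrite -sum1dep_card [RHS]big_mkcond /=; apply: eq_bigr => k _.
  by rewrite !mxE; case: eqP.
under eq_bigr => j _.
  under eq_bigr => i _ do rewrite -[#|_|]muln1.
  over.
rewrite big_distrl /= -[X in (X * _)%N]card_ord -sum_nat_const.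
apply: eq_bigr => j _; rewrite big_distrl /=.
under eq_bigr => i _ do rewrite muln1 (eqP (forallP (balX j) (X i j))).
by rewrite sum_nat_const card_ord.
Qed.

(** Removing the diagonal [n * s] from the total over ordered pairs and halving leaves s n (n - q) /
    (2 q). *)
Lemma sum_pc_vector {R : realType} {n q s : nat} {X : design n q s} :
  (2 <= n)%N -> (0 < q)%N -> balanced X ->
  \sum_(r < npairs n) tnth (pc_vector R X) r =
    (npairs n)%:R * mean_coincidence R n q s.
Proof.
move=> n2 q0 balX.
rewrite -(big_tuple _ _ (pc_vector R X) xpredT id) /= big_map -natr_sum.
have := sum_coincidence_all balX.
rewrite sum_sym_pairs; last by move=> i k; exact: coincidence_sym.
under [X in (_ + X)%N]eq_bigr do rewrite coincidence_id.
rewrite sum_nat_const card_ord; set S := (\sum_(p <- _) _)%N.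
move=> /(congr1 (fun k => k%:R : R)).
rewrite !(natrM, natrD, natrX) => eqS.
(* The halving in [npairs] is exact, since it is a binomial coefficient. *)
have binE := bin2 n; rewrite -/(npairs n) in binE.
have eqm : (npairs n)%:R * 2 = n%:R * (n%:R - 1) :> R.
  rewrite -binE -natrM mulnC -mul_bin_diag bin1 natrM.
  by rewrite -subn1 natrB // ltnW.
have qN : q%:R != 0 :> R by rewrite pnatr_eq0 -lt0n.
have nN : n%:R - 1 != 0 :> R by rewrite subr_eq0 -[1]/(1%:R) eqr_nat gtn_eqF.
rewrite /mean_coincidence.
have -> : (npairs n)%:R = n%:R * (n%:R - 1) / 2 :> R by rewrite -eqm; field.
apply: (mulIf qN); apply: (@mulfI _ 2); first by rewrite pnatr_eq0.
have -> : 2 * (S%:R * q%:R) = s%:R * n%:R ^+ 2 - n%:R * s%:R * q%:R :> R.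
  by rewrite -eqS; ring.
by field; rewrite qN nN.
Qed.

Lemma pc_vector_nat {R : realType} {n q s : nat} (X : design n q s) r :
  exists k : nat, tnth (pc_vector R X) r = k%:R.
Proof. by rewrite tnth_map; eexists. Qed.

Theorem theorem1 (R : realType) (n q s : nat)
    (hn : (2 <= n)%N) (hq : (2 <= q)%N) (hs : (1 <= s)%N)
    (D : {set design n q s}) (hD : D \subset balanced_designs n q s) :
  (forall X : design n q s, X \in D ->
     majorant R D X <->
     (forall psi : R -> R, convex_kernel psi -> schur_optimum psi D X)) /\
  (forall psi : R -> R, convex_kernel psi ->
     forall X : design n q s, X \in D ->
       (npairs n)%:R * (1 - frac_part R n q s) * psi (theta R n q s)%:~R
         + (npairs n)%:R * frac_part R n q s * psi ((theta R n q s)%:~R + 1)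
       <= schur_criterion psi X).
Proof.
split=> [X XD|psi psiC X XD].
  split=> [[_ majX] psi psiC|optX]; split=> // X' X'D.
    apply: (majorized_sum_le (P := fun a => exists k : nat, a = k%:R)
      (slope := fun a => psi (a + 1) - psi a)) (majX X' X'D).
    - by move=> _ _ [a ->] [b ->]; exact: convex_kernel_support.
    - exact: pc_vector_nat.
    - exact: pc_vector_nat.
  apply: majorized_of_convex_kernel => psi /optX[_]; exact.
have balX : balanced X by have := fintype.subsetP hD _ XD; rewrite inE.
have sumX := sum_pc_vector (R := R) hn (ltnW hq) balX.
have m_gt0 : 0 < (npairs n)%:R :> R by rewrite ltr0n /npairs -bin2 bin_gt0.
(* As an average of coincidences the mean is nonnegative, so its floor is a natural number [t],
   where a supporting line is available. *)
have mean_ge0 : 0 <= mean_coincidence R n q s.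
  rewrite -(pmulr_rge0 _ m_gt0) -sumX; apply: sumr_ge0 => r _.
  by have [k ->] := pc_vector_nat (R := R) X r.
rewrite /frac_part.
have : 0 <= theta R n q s by rewrite floor_ge0.
case: (theta R n q s) => // t _; rewrite -pmulrn.
(* The entries deviate from [t] by the fractional part on average, so the supporting line at [t]
   sums exactly to the bound. *)
apply: (@le_trans _ _ (\sum_(r < npairs n)
  (psi t%:R + (psi (t%:R + 1) - psi t%:R) * (tnth (pc_vector R X) r - t%:R)))).
  rewrite big_split -mulr_sumr sumrB sumX !sumr_const card_ord /=.
  by rewrite -[psi _ *+ _]mulr_natl -[t%:R *+ _]mulr_natl; lra.
apply: ler_sum => r _; have [k ->] := pc_vector_nat (R := R) X r.
exact: convex_kernel_support.
Qed.
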